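(* Let $\mathcal{A}\subseteq\mathbb{R}^k$ be a finite nonempty set, $d$ a metric on $\mathbb{R}^k$ and $q\ge1$. The function $g:\mathbb{R}_+\to\mathbb{R}$, $g(C)=\min_{\xi\in\mathbb{R}^k} f_C(\xi,\mathcal{A})$, is continuous, non-decreasing and concave.
   Context: $d^q(x,y)=(d(x,y))^q$, $\mathbb{R}_+=[0,\infty)$, and $f_C(x,\mathcal{A})=\sum_{a\in\mathcal{A}}\min\{d^q(x,a),C\}$. The minima over $\mathbb{R}^k$ of $f_C(\cdot,\mathcal{A})$ for $C\ge0$, and of $x\mapsto\sum_{a\in A}d^q(x,a)$ for subsets $A\subseteq\mathcal{A}$, are understood to be attained (automatic if $d$ is derived from a norm). *)

(* Defs.v *)
From HB Require Import structures.
From mathcomp Require Import all_boot all_order all_algebra finmap.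
From mathcomp Require Import all_classical all_reals all_analysis.

Set Implicit Arguments.
Unset Strict Implicit.
Unset Printing Implicit Defensive.

Import Order.TTheory GRing.Theory Num.Theory.
Import numFieldNormedType.Exports.

Local Open Scope classical_set_scope.
Local Open Scope ring_scope.

(* Stated for a bare function: the row vectors ['rV[R]_k] already carry a
   canonical (sup-norm) metric, whereas [d] is arbitrary. *)
Definition is_metric (R : realType) (T : Type) (d : T -> T -> R) : Prop :=
  [/\ forall x y, 0 <= d x y,
      forall x y, d x y = 0 <-> x = y,
      forall x y, d x y = d y x
    & forall x y z, d x z <= d x y + d y z].

Definition is_minimum (R : realType) (S : set R) (m : R) : Prop :=
  S m /\ lbound S m.

Definition attains_min (R : realType) (T : Type) (F : T -> R) : Prop :=
  exists m, is_minimum (range F) m.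

(* The value is junk (0) when [F] does not attain a minimum. *)
Definition min_value (R : realType) (T : Type) (F : T -> R) : R :=
  xget 0 (is_minimum (range F)).

Definition dist_sum (R : realType) (k : nat)
    (d : 'rV[R]_k -> 'rV[R]_k -> R) (q : R) (A : {fset 'rV[R]_k})
    (x : 'rV[R]_k) : R :=
  \sum_(a <- A) d x a `^ q.

Definition trunc_dist_sum (R : realType) (k : nat)
    (d : 'rV[R]_k -> 'rV[R]_k -> R) (q C : R) (A : {fset 'rV[R]_k})
    (x : 'rV[R]_k) : R :=
  \sum_(a <- A) Num.min (d x a `^ q) C.

Definition concave_function (R : realType) (D : set R) (f : R -> R) : Prop :=
  @convex_function R R^o D (fun x => - f x).

(* Main.v *)
Require Import Defs.
From HB Require Import structures.
From mathcomp Require Import all_boot all_order all_algebra finmap.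
From mathcomp Require Import all_classical all_reals all_analysis.
From mathcomp Require Import unstable lra.

Set Implicit Arguments.
Unset Strict Implicit.
Unset Printing Implicit Defensive.

Import Order.TTheory GRing.Theory Num.Theory.
Import numFieldNormedType.Exports.

Local Open Scope classical_set_scope.
Local Open Scope ring_scope.

(** For each point [x], the map [C |-> f_C(x)] is a sum of the functions
    [C |-> min(u, C)], each non-decreasing, concave and 1-Lipschitz.  Monotonicity
    and concavity pass to the pointwise minimum over [x]; so does the Lipschitz
    bound, whose constant [#|A|] does not depend on [x], and this gives continuity
    up to the endpoint [0]. *)

Lemma min_value_is_minimum (R : realType) (T : Type) (F : T -> R) :
  attains_min F -> is_minimum (range F) (min_value F).
Proof. exact: xgetPex. Qed.

Lemma min_value_le (R : realType) (T : Type) (F : T -> R) (x : T) :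
  attains_min F -> min_value F <= F x.
Proof. by move=> /min_value_is_minimum[_]; apply; exists x. Qed.

Lemma min_value_attained (R : realType) (T : Type) (F : T -> R) :
  attains_min F -> exists x, min_value F = F x.
Proof. by move=> /min_value_is_minimum[[x _ <-] _]; exists x. Qed.

(** The bound is asked only for ordered pairs, where the monotonicity of [f] can later be used;
    symmetry of the distance gives the other order. *)
Lemma lipschitz_within_continuous (R : realType) (D : set R) (f : R -> R)
    (K : R) :
  0 <= K ->
  (forall x y, D x -> D y -> x <= y -> `|f x - f y| <= K * (y - x)) ->
  {within D, continuous f}.
Proof.
move=> K_ge0 f_lip; apply/subspace_continuousP => x Dx.
apply/cvgrPdist_le => e e_gt0.
(* [K] may be 0, so the radius is [e / (K + 1)] rather than [e / K]. *)
have K1_gt0 : 0 < K + 1 by lra.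
rewrite near_withinE; near=> y => Dy.
have xy : `|x - y| <= e / (K + 1).
  by near: y; apply: cvgr_dist_le; [exact: cvg_id | exact: divr_gt0].
have f_xy : `|f x - f y| <= K * `|x - y|.
  have [le_xy|lt_yx] := leP x y.
    by rewrite (distrC x) (@ger0_norm _ (y - x)) ?subr_ge0// f_lip.
  by rewrite distrC (@gtr0_norm _ (x - y)) ?subr_gt0// f_lip// ltW.
rewrite (le_trans f_xy)// (le_trans (y := (K + 1) * `|x - y|))//.
  by rewrite ler_wpM2r//; lra.
by rewrite mulrC -ler_pdivlMr.
Unshelve. all: by end_near.
Qed.

Section TruncDistSum.
Variables (R : realType) (k : nat) (d : 'rV[R]_k -> 'rV[R]_k -> R) (q : R).
Variables (A : {fset 'rV[R]_k}).
Implicit Types (C s t : R) (x : 'rV[R]_k).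

Lemma trunc_dist_sum_le C C' x : C <= C' ->
  trunc_dist_sum d q C A x <= trunc_dist_sum d q C' A x.
Proof. by move=> CC'; apply: ler_sum => a _; apply: le_min2. Qed.

(** Raising the cap from [C] to [C'] raises each of the [size A] summands by at most [C' - C],
    whatever [x] is. *)
Lemma trunc_dist_sum_lipschitz C C' x : C <= C' ->
  trunc_dist_sum d q C' A x <=
    trunc_dist_sum d q C A x + (size A)%:R * (C' - C).
Proof.
move=> CC'.
have -> : (size A)%:R * (C' - C) = \sum_(a <- A) (C' - C).
  by rewrite big_const_seq count_predT iter_addr_0 mulr_natl.
rewrite -big_split/=; apply: ler_sum => a _; set u := _ `^ _.
by have [|] := leP u C; have [|] := leP u C'; lra.
Qed.

Lemma trunc_dist_sum_concave s t C C' x : 0 <= s -> 0 <= t -> s + t = 1 ->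
  s * trunc_dist_sum d q C A x + t * trunc_dist_sum d q C' A x <=
    trunc_dist_sum d q (s * C + t * C') A x.
Proof.
move=> s_ge0 t_ge0 st1; rewrite !mulr_sumr -big_split/=.
apply: ler_sum => a _; set u := _ `^ _.
(* The left side is compared with each argument of the right-hand minimum: with [s * C + t * C']
   termwise, and with [u] after writing [u = s * u + t * u]. *)
rewrite le_min; apply/andP; split; last first.
  by rewrite lerD// ler_wpM2l// ge_min lexx orbT.
rewrite -[leRHS]mul1r -st1 mulrDl.
by rewrite lerD// ler_wpM2l// ge_min lexx.
Qed.

End TruncDistSum.

Theorem theorem30 (R : realType) (k : nat)
    (A : {fset 'rV[R]_k}) (A_neq0 : A <> fset0)
    (d : 'rV[R]_k -> 'rV[R]_k -> R) (d_metric : is_metric d)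
    (q : R) (q_ge1 : 1 <= q)
    (min_trunc : forall C : R, 0 <= C -> attains_min (trunc_dist_sum d q C A))
    (min_sub : forall B : {fset 'rV[R]_k}, (B `<=` A)%fset ->
       attains_min (dist_sum d q B)) :
  let g := fun C : R => min_value (trunc_dist_sum d q C A) in
  [/\ {within `[0, +oo[, continuous g},
      forall C C' : R, 0 <= C -> C <= C' -> g C <= g C'
    & concave_function `[0, +oo[ g].
Proof.
move=> g.
have g_le C C' : 0 <= C -> C <= C' -> g C <= g C'.
  move=> C_ge0 CC'.
  (* A minimiser for the larger cap [C'] is a competitor for [C]. *)
  have [x gC'E] := min_value_attained (min_trunc C' (le_trans C_ge0 CC')).
  rewrite /g gC'E (le_trans _ (trunc_dist_sum_le _ _ _ _ CC'))//.
  exact/min_value_le/min_trunc.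
split=> //.
  apply: (@lipschitz_within_continuous _ _ _ (size A)%:R) => // C C'.
  rewrite /= !in_itv/= !andbT => C_ge0 C'_ge0 CC'.
  (* Monotonicity removes the absolute value. What remains is an upper bound on [g C'], obtained by
     testing it at a minimiser for [C]. *)
  rewrite distrC ger0_norm ?subr_ge0 ?g_le// lerBlDl.
  have [x gCE] := min_value_attained (min_trunc C C_ge0).
  rewrite /g gCE (le_trans _ (trunc_dist_sum_lipschitz _ _ _ x CC'))//.
  exact/min_value_le/min_trunc.
move=> t C C' /[!inE]/= /[!in_itv]/= /[!andbT] C_ge0 C'_ge0.
rewrite -convN lerN2 !convRE.
set s := t%:num; set s' := s.~.
have s_ge0 : 0 <= s by rewrite /s.
have s'_ge0 : 0 <= s' by rewrite onem_ge0 /s.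
have ss'1 : s + s' = 1 by exact: add_onemK.
have sC_ge0 : 0 <= s * C + s' * C' by rewrite addr_ge0 ?mulr_ge0.
(* A minimiser at the intermediate cap bounds both [g C] and [g C'] from above, so concavity at this
   single [x] suffices. *)
have [x gE] := min_value_attained (min_trunc _ sC_ge0).
rewrite /g gE.
apply: le_trans (trunc_dist_sum_concave d q A C C' x s_ge0 s'_ge0 ss'1).
by rewrite lerD// ler_wpM2l//; exact/min_value_le/min_trunc.
Qed.
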